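(* Let $\gamma \geq 0$ be an integer. The operad $\mathsf{Dendr}_\gamma$ admits the following presentation. It is generated by $\{\prec_b, \succ_b : b \in [\gamma]\}$ and its space of relations is generated by $$\prec_a \circ_1 \succ_{a'} - \succ_{a'} \circ_2 \prec_a, \qquad a, a' \in [\gamma],$$ $$\prec_a \circ_1 \prec_b - \prec_a \circ_2 \succ_b - \prec_a \circ_2 \prec_a, \qquad a < b \in [\gamma],$$ $$\succ_a \circ_1 \succ_a + \succ_a \circ_1 \prec_b - \succ_a \circ_2 \succ_b, \qquad a < b \in [\gamma],$$ $$\prec_b \circ_1 \prec_a - \prec_a \circ_2 \prec_b - \prec_a \circ_2 \succ_a, \qquad a < b \in [\gamma],$$ $$\succ_a \circ_1 \prec_a + \succ_a \circ_1 \succ_b - \succ_b \circ_2 \succ_a, \qquad a < b \in [\gamma],$$ $$\prec_a \circ_1 \prec_a - \prec_a \circ_2 \succ_a - \prec_a \circ_2 \prec_a, \qquad a \in [\gamma],$$ $$\succ_a \circ_1 \succ_a + \succ_a \circ_1 \prec_a - \succ_a \circ_2 \succ_a, \qquad a \in [\gamma].$$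
   Context: The ground field has characteristic zero; operad means nonsymmetric operad; $[n] = \{1, \dots, n\}$; $a \uparrow a' := \max(a, a')$. $\mathbf{Free}(\mathfrak{G})$ is the free operad on a set $\mathfrak{G}$ of binary generators; $(\mathfrak{G}, \mathfrak{R})$ is a presentation of $\mathcal{O}$ if $\mathcal{O} \cong \mathbf{Free}(\mathfrak{G})/\langle \mathfrak{R} \rangle$, with $\langle \mathfrak{R} \rangle$ the operad ideal generated by the subspace $\mathfrak{R}$. Koszul dual: if $\mathcal{O}$ has a presentation $(\mathfrak{G}, \mathfrak{R})$ with $\mathfrak{G}$ in arity $2$ and $\mathfrak{R} \subseteq \mathbf{Free}(\mathfrak{G})(3)$, its Koszul dual is $\mathbf{Free}(\mathfrak{G})/\langle \mathfrak{R}^\perp \rangle$, where $\mathfrak{R}^\perp$ is the annihilator of $\mathfrak{R}$ in $\mathbf{Free}(\mathfrak{G})(3)$ for the bilinear form with $\langle x \circ_i y, x' \circ_{i'} y' \rangle = 1$ if $x = x', y = y', i = i' = 1$; $= -1$ if $x = x', y = y', i = i' = 2$; and $0$ otherwise ($x, x', y, y' \in \mathfrak{G}$). $\mathsf{Dias}_\gamma$ is the operad presented by binary generators $\dashv_a, \vdash_a$, $a \in [\gamma]$, and the space of relations spanned, for all $a, a' \in [\gamma]$, by $\dashv_a \circ_1 \vdash_{a'} - \vdash_{a'} \circ_2 \dashv_a$; $\dashv_a \circ_1 \dashv_{a \uparrow a'} - \dashv_a \circ_2 \vdash_{a'}$; $\vdash_a \circ_1 \dashv_{a'} - \vdash_a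 \circ_2 \vdash_{a \uparrow a'}$; $\dashv_{a \uparrow a'} \circ_1 \dashv_a - \dashv_a \circ_2 \dashv_{a'}$; $\vdash_a \circ_1 \vdash_{a'} - \vdash_{a \uparrow a'} \circ_2 \vdash_a$. $\mathsf{Dendr}_\gamma$ is the Koszul dual of $\mathsf{Dias}_\gamma$ computed from this presentation, where in the dual the generators corresponding to $\dashv_a$ and $\vdash_a$ are denoted by $\leftharpoonup_a$ and $\rightharpoonup_a$ respectively. In $\mathbf{Free}(\{\leftharpoonup_a, \rightharpoonup_a : a \in [\gamma]\})(2)$ set, for $b \in [\gamma]$, $\prec_b := \sum_{a \in [b]} \leftharpoonup_a$ and $\succ_b := \sum_{a \in [b]} \rightharpoonup_a$. These elements form a basis of this space, so that the free operads on $\{\leftharpoonup_a, \rightharpoonup_a\}$ and on $\{\prec_b, \succ_b\}$ are identified. *)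

(* Defs.v *)
From HB Require Import structures.
From mathcomp Require Import all_boot all_order all_algebra.
From mathcomp Require Import boolp finmap.
From mathcomp.multinomials Require Import monalg.
From mathcomp Require Import zify ring.

Set Implicit Arguments.
Unset Strict Implicit.
Unset Printing Implicit Defensive.

Import Order.TTheory GRing.Theory.
Local Open Scope quotient_scope.
Local Open Scope ring_scope.

(* Positions are 0-based: for i : 'I_n, [pcomp e i x y] is the partial       *)
(* composition x o_(i+1) y.  The arity of the result is an index k given     *)
(* with a proof that n + m = k + 1, so that the axioms need no casts.        *)
Record operad (K : fieldType) := Operad {
  component :> nat -> lmodType K;
  op_unit : component 1;
  pcomp : forall n m k : nat, (n + m)%N = k.+1 ->
    'I_n -> component n -> component m -> component k;
  pcomp_linearl : forall n m k (e : (n + m)%N = k.+1) (i : 'I_n) y,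
    linear (fun x => pcomp e i x y);
  pcomp_linearr : forall n m k (e : (n + m)%N = k.+1) (i : 'I_n) x,
    linear (fun y => pcomp e i x y);
  pcomp_seq : forall n m p nm mp k
      (e1 : (n + m)%N = nm.+1) (e2 : (nm + p)%N = k.+1)
      (e3 : (m + p)%N = mp.+1) (e4 : (n + mp)%N = k.+1)
      (i : 'I_n) (j : 'I_m) (l : 'I_nm) x y z,
    l = (i + j)%N :> nat ->
    pcomp e2 l (pcomp e1 i x y) z = pcomp e4 i x (pcomp e3 j y z);
  pcomp_par : forall n m p nm np k
      (e1 : (n + m)%N = nm.+1) (e2 : (nm + p)%N = k.+1)
      (e3 : (n + p)%N = np.+1) (e4 : (np + m)%N = k.+1)
      (i j : 'I_n) (l : 'I_nm) (i' : 'I_np) x y z,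
    (i < j)%N -> l.+1 = (j + m)%N -> i' = i :> nat ->
    pcomp e2 l (pcomp e1 i x y) z = pcomp e4 i' (pcomp e3 j x z) y;
  pcomp_unitl : forall n (e : (1 + n)%N = n.+1) x,
    pcomp e ord0 op_unit x = x;
  pcomp_unitr : forall n (e : (n + 1)%N = n.+1) (i : 'I_n) x,
    pcomp e i x op_unit = x
}.

Arguments op_unit {K} _.
Arguments pcomp {K o n m k} e i x y.

Lemma pcompBl (K : fieldType) (O : operad K) n m k (e : (n + m)%N = k.+1)
    (i : 'I_n) (x x' : O n) (y : O m) :
  pcomp e i (x - x') y = pcomp e i x y - pcomp e i x' y.
Proof.
have /= := pcomp_linearl e i y (-1) x' x.
by rewrite !scaleN1r => h; rewrite addrC h addrC.
Qed.

Lemma pcompBr (K : fieldType) (O : operad K) n m k (e : (n + m)%N = k.+1)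
    (i : 'I_n) (x : O n) (y y' : O m) :
  pcomp e i x (y - y') = pcomp e i x y - pcomp e i x y'.
Proof.
have /= := pcomp_linearr e i x (-1) y' y.
by rewrite !scaleN1r => h; rewrite addrC h addrC.
Qed.

Notation "x \circ1 y" := (pcomp (erefl 4 : (2 + 2)%N = 3.+1) ord0 x y)
  (at level 40, no associativity) : ring_scope.
Notation "x \circ2 y" := (pcomp (erefl 4 : (2 + 2)%N = 3.+1) ord_max x y)
  (at level 40, no associativity) : ring_scope.

Record operad_morphism (K : fieldType) (O P : operad K) := OperadMorphism {
  mor_fun :> forall n, {linear O n -> P n};
  mor_unit : mor_fun 1 (op_unit O) = op_unit P;
  mor_pcomp : forall n m k (e : (n + m)%N = k.+1) (i : 'I_n)
      (x : O n) (y : O m),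
    mor_fun k (pcomp e i x y) = pcomp e i (mor_fun n x) (mor_fun m y)
}.

Definition operad_isomorphism (K : fieldType) (O P : operad K)
    (phi : operad_morphism O P) : Prop :=
  forall n, bijective (phi n).

Definition subspace (K : fieldType) (V : lmodType K) (S : V -> Prop) : Prop :=
  S 0 /\ forall (c : K) (u v : V), S u -> S v -> S (c *: u + v).

Definition lspan (K : fieldType) (V : lmodType K) (S : V -> Prop) : V -> Prop :=
  fun v => forall W : V -> Prop, subspace W -> (forall u, S u -> W u) -> W v.

Section Ideals.
Variables (K : fieldType) (O : operad K).

Record ideal := Ideal {
  ideal_mem :> forall n, O n -> Prop;
  ideal_subspace : forall n, subspace (@ideal_mem n);
  ideal_pcompl : forall n m k (e : (n + m)%N = k.+1) (i : 'I_n)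
    (x : O n) (y : O m), ideal_mem x -> ideal_mem (pcomp e i x y);
  ideal_pcompr : forall n m k (e : (n + m)%N = k.+1) (i : 'I_n)
    (x : O n) (y : O m), ideal_mem y -> ideal_mem (pcomp e i x y)
}.

Definition gen_ideal_mem (p : nat) (S : O p -> Prop) n (x : O n) : Prop :=
  forall I : ideal, (forall y : O p, S y -> I p y) -> I n x.

Lemma gen_ideal_subspace p (S : O p -> Prop) n :
  subspace (@gen_ideal_mem p S n).
Proof.
split=> [I _|c u v hu hv I hS]; first by case: (ideal_subspace I n).
by case: (ideal_subspace I n) => _; apply; [apply: hu|apply: hv].
Qed.

Lemma gen_ideal_pcompl p (S : O p -> Prop) n m k (e : (n + m)%N = k.+1)
    (i : 'I_n) (x : O n) (y : O m) :
  gen_ideal_mem S x -> gen_ideal_mem S (pcomp e i x y).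
Proof. by move=> h I hS; apply: ideal_pcompl; apply: h. Qed.

Lemma gen_ideal_pcompr p (S : O p -> Prop) n m k (e : (n + m)%N = k.+1)
    (i : 'I_n) (x : O n) (y : O m) :
  gen_ideal_mem S y -> gen_ideal_mem S (pcomp e i x y).
Proof. by move=> h I hS; apply: ideal_pcompr; apply: h. Qed.

Definition gen_ideal (p : nat) (S : O p -> Prop) : ideal :=
  Ideal (gen_ideal_subspace S) (@gen_ideal_pcompl p S) (@gen_ideal_pcompr p S).

End Ideals.

Section QuotientModule.
Variables (K : fieldType) (V : lmodType K) (S : V -> Prop).
Hypothesis subS : subspace S.

Definition subspace_pred of subspace S : V -> bool := fun v => `[< S v >].

Lemma subspace_pred_closed : GRing.submod_closed (subspace_pred subS).
Proof.
case: (subS) => S0 SD; split; first exact/asboolP.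
by move=> c u v /asboolP hu /asboolP hv; apply/asboolP; apply: SD.
Qed.

HB.instance Definition _ :=
  GRing.isSubmodClosed.Build K V (subspace_pred subS) subspace_pred_closed.

Definition quotient_module : Type :=
  Quotient.quot (GRing.ZmodClosed.clone V (subspace_pred subS) _).

HB.instance Definition _ := GRing.Zmodule.on quotient_module.

Definition to_quot (v : V) : quotient_module := \pi_quotient_module v.
Definition of_quot (a : quotient_module) : V := repr a.

Lemma of_quotK : cancel of_quot to_quot.
Proof. exact: reprK. Qed.

Lemma to_quotP u v : to_quot u = to_quot v <-> S (u - v).
Proof.
split=> [/eqP|h]; last apply/eqP.
  by rewrite -Quotient.idealrBE => /asboolP.
by rewrite -Quotient.idealrBE; apply/asboolP.
Qed.

Lemma to_quotD u v : to_quot (u + v) = to_quot u + to_quot v.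
Proof. exact: raddfD. Qed.

Lemma of_to_quot u : S (of_quot (to_quot u) - u).
Proof. by apply/to_quotP; rewrite of_quotK. Qed.

Definition quot_scale (c : K) (a : quotient_module) : quotient_module :=
  to_quot (c *: of_quot a).

Lemma quot_scaleE c u : quot_scale c (to_quot u) = to_quot (c *: u).
Proof.
apply/to_quotP; rewrite -scalerBr -[_ *: _]addr0.
by case: subS => S0; apply=> //; apply: of_to_quot.
Qed.

Lemma quot_scaleA a b v : quot_scale a (quot_scale b v) = quot_scale (a * b) v.
Proof. by rewrite -[v]of_quotK !quot_scaleE scalerA. Qed.

Lemma quot_scale1 : left_id 1 quot_scale.
Proof. by move=> v; rewrite -[v]of_quotK quot_scaleE scale1r. Qed.

Lemma quot_scaleDr : right_distributive quot_scale +%R.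
Proof.
move=> c u v; rewrite -[u]of_quotK -[v]of_quotK -to_quotD !quot_scaleE.
by rewrite -to_quotD scalerDr.
Qed.

Lemma quot_scaleDl v : {morph quot_scale^~ v : a b / a + b}.
Proof.
by move=> a b; rewrite -[v]of_quotK !quot_scaleE -to_quotD scalerDl.
Qed.

HB.instance Definition _ := GRing.Zmodule_isLmodule.Build K quotient_module
  quot_scaleA quot_scale1 quot_scaleDr quot_scaleDl.

Lemma to_quot_linear : linear to_quot.
Proof. by move=> c u v; rewrite to_quotD -quot_scaleE. Qed.

HB.instance Definition _ :=
  GRing.isLinear.Build K V quotient_module _ to_quot to_quot_linear.

End QuotientModule.

Section QuotientOperad.
Variables (K : fieldType) (O : operad K) (I : ideal O).

Definition quot_car n : lmodType K := quotient_module (ideal_subspace I n).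

Definition quot_class n (x : O n) : quot_car n :=
  to_quot (ideal_subspace I n) x.

Definition quot_pcomp n m k (e : (n + m)%N = k.+1) (i : 'I_n)
    (a : quot_car n) (b : quot_car m) : quot_car k :=
  quot_class (pcomp e i (of_quot a) (of_quot b)).

Lemma quot_classP n (x y : O n) : quot_class x = quot_class y <-> I n (x - y).
Proof. exact: to_quotP. Qed.

Lemma quot_class_surj n (a : quot_car n) : exists x, a = quot_class x.
Proof. by exists (of_quot a); rewrite /quot_class of_quotK. Qed.

Lemma quot_class_linear n : linear (@quot_class n).
Proof. exact: to_quot_linear. Qed.

HB.instance Definition _ n := GRing.isLinear.Build K (O n) (quot_car n) _
  (@quot_class n) (@quot_class_linear n).

Lemma quot_pcompE n m k (e : (n + m)%N = k.+1) (i : 'I_n) (x : O n) (y : O m) :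
  quot_pcomp e i (quot_class x) (quot_class y) = quot_class (pcomp e i x y).
Proof.
apply/quot_classP; set x' := of_quot _; set y' := of_quot _.
have -> : pcomp e i x' y' - pcomp e i x y =
    pcomp e i (x' - x) y' + pcomp e i x (y' - y).
  by rewrite pcompBl pcompBr addrA subrK.
rewrite -[pcomp e i (_ - _) _]scale1r; case: (ideal_subspace I k) => _; apply.
  by apply: ideal_pcompl; apply: of_to_quot.
by apply: ideal_pcompr; apply: of_to_quot.
Qed.

Lemma quot_pcomp_linearl n m k (e : (n + m)%N = k.+1) (i : 'I_n) y :
  linear (fun x => quot_pcomp e i x y).
Proof.
move=> c u v; have [u' ->] := quot_class_surj u.
have [v' ->] := quot_class_surj v; have [y' ->] := quot_class_surj y.
by rewrite -quot_class_linear !quot_pcompE (pcomp_linearl e i) quot_class_linear.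
Qed.

Lemma quot_pcomp_linearr n m k (e : (n + m)%N = k.+1) (i : 'I_n) x :
  linear (fun y => quot_pcomp e i x y).
Proof.
move=> c u v; have [u' ->] := quot_class_surj u.
have [v' ->] := quot_class_surj v; have [x' ->] := quot_class_surj x.
by rewrite -quot_class_linear !quot_pcompE (pcomp_linearr e i) quot_class_linear.
Qed.

Definition quotient_operad : operad K.
Proof.
refine (@Operad K quot_car (quot_class (op_unit O)) quot_pcomp
  quot_pcomp_linearl quot_pcomp_linearr _ _ _ _).
- move=> n m p nm mp k e1 e2 e3 e4 i j l x y z h.
  have [x' ->] := quot_class_surj x; have [y' ->] := quot_class_surj y.
  have [z' ->] := quot_class_surj z.
  by rewrite !quot_pcompE (pcomp_seq e1 e2 e3 e4 _ _ _ h).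
- move=> n m p nm np k e1 e2 e3 e4 i j l i' x y z h1 h2 h3.
  have [x' ->] := quot_class_surj x; have [y' ->] := quot_class_surj y.
  have [z' ->] := quot_class_surj z.
  by rewrite !quot_pcompE (pcomp_par e1 e2 e3 e4 _ _ _ h1 h2 h3).
- move=> n e x; have [x' ->] := quot_class_surj x.
  by rewrite quot_pcompE pcomp_unitl.
- move=> n e i x; have [x' ->] := quot_class_surj x.
  by rewrite quot_pcompE pcomp_unitr.
Defined.

End QuotientOperad.

Inductive tree (G : Type) :=
  | Leaf : tree G
  | Node : G -> tree G -> tree G -> tree G.
Arguments Leaf {G}.

Section Trees.
Variable G : Type.

Fixpoint leaves (t : tree G) : nat :=
  if t is Node _ l r then (leaves l + leaves r)%N else 1%N.

Fixpoint graft (t : tree G) (i : nat) (s : tree G) : tree G :=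
  match t with
  | Leaf => s
  | Node g l r => if (i < leaves l)%N then Node g (graft l i s) r
                  else Node g l (graft r (i - leaves l) s)
  end.

Lemma leaves_gt0 t : (0 < leaves t)%N.
Proof. by elim: t => //= g l hl r hr; rewrite addn_gt0 hl. Qed.

Lemma leaves_graft t i s : (i < leaves t)%N ->
  (leaves (graft t i s)).+1 = (leaves t + leaves s)%N.
Proof.
elim: t i => [|g l IHl r IHr] i /=; first by rewrite add1n.
case: (ltnP i (leaves l)) => h hi /=; first by have := IHl _ h; lia.
by have := IHr (i - leaves l)%N; lia.
Qed.

Lemma graft_leaf t i : (i < leaves t)%N -> graft t i Leaf = t.
Proof.
elim: t i => [|g l IHl r IHr] i //=.
by case: (ltnP i (leaves l)) => h hi; rewrite ?IHl ?IHr //; lia.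
Qed.

Lemma graft_seq t i s j u : (i < leaves t)%N -> (j < leaves s)%N ->
  graft (graft t i s) (i + j) u = graft t i (graft s j u).
Proof.
elim: t i => [|g l IHl r IHr] i /=; first by case: i.
case: (ltnP i (leaves l)) => h hi hj /=.
  have hl := leaves_graft s h.
  have -> : (i + j < leaves (graft l i s))%N by lia.
  by rewrite IHl.
have -> : (i + j < leaves l)%N = false by lia.
have -> : (i + j - leaves l = i - leaves l + j)%N by lia.
by rewrite IHr //; lia.
Qed.

Lemma graft_par t i j s u : (i < j)%N -> (j < leaves t)%N ->
  graft (graft t i s) (j + leaves s).-1 u = graft (graft t j u) i s.
Proof.
elim: t i j => [|g l IHl r IHr] i j /=; first by case: j.
move=> hij hj; have s0 := leaves_gt0 s; have u0 := leaves_gt0 u.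
case: (ltnP j (leaves l)) => hjl.
  have hil := ltn_trans hij hjl; rewrite hil /=.
  have hl := leaves_graft s hil; have hu := leaves_graft u hjl.
  have -> : ((j + leaves s).-1 < leaves (graft l i s))%N by lia.
  have -> : (i < leaves (graft l j u))%N by lia.
  by rewrite IHl.
case: (ltnP i (leaves l)) => hil /=; rewrite ?hil ?(ltnNge i) ?hil /=.
  have hl := leaves_graft s hil.
  have -> : ((j + leaves s).-1 < leaves (graft l i s))%N = false by lia.
  by congr (Node g _ (graft r _ u)); lia.
have -> : ((j + leaves s).-1 < leaves l)%N = false by lia.
rewrite -IHr; [|lia|lia].
by congr (Node g l (graft _ _ u)); lia.
Qed.

End Trees.

Section NTrees.
Variable G : Type.

Definition ntree (n : nat) := {t : tree G | leaves t == n}.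

HB.instance Definition _ n := gen_eqMixin (ntree n).
HB.instance Definition _ n := gen_choiceMixin (ntree n).

Definition leaf_ntree : ntree 1 := exist _ Leaf (eqxx 1%N).

Definition corolla (g : G) : ntree 2 := exist _ (Node g Leaf Leaf) (eqxx 2%N).

Lemma ntree_graft_subproof n m k (e : (n + m)%N = k.+1) (i : 'I_n)
    (t : ntree n) (s : ntree m) : leaves (graft (val t) i (val s)) == k.
Proof.
case: t s => [t /= /eqP ht] [s /= /eqP hs].
by rewrite -eqSS leaves_graft ?ht ?hs ?e.
Qed.

Definition ntree_graft n m k (e : (n + m)%N = k.+1) (i : 'I_n)
    (t : ntree n) (s : ntree m) : ntree k :=
  exist _ (graft (val t) i (val s)) (ntree_graft_subproof e i t s).

End NTrees.

Section LinearExtension.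
Variables (K : fieldType) (T : choiceType).

Definition lin_ext (V : lmodType K) (f : T -> V) (x : {malg K[T]}) : V :=
  \sum_(t <- msupp x) x@_t *: f t.

Variable V : lmodType K.
Implicit Types (f : T -> V) (x y : {malg K[T]}).

Lemma lin_extEw f x (d : {fset T}) : (msupp x `<=` d)%fset ->
  lin_ext f x = \sum_(t <- d) x@_t *: f t.
Proof.
move=> hd; rewrite /lin_ext (big_fset_incl _ hd) // => t _ ht.
by rewrite mcoeff_outdom // scale0r.
Qed.

Lemma lin_ext_linear f : linear (lin_ext f).
Proof.
move=> c x y; pose d := (msupp x `|` msupp y `|` msupp (c *: x + y))%fset.
rewrite !(@lin_extEw _ _ d) /d; try by apply/fsubsetP=> t; rewrite !inE => ->; rewrite ?orbT.
rewrite scaler_sumr -big_split; apply: eq_bigr => t _.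
by rewrite mcoeffD mcoeffZ scalerDl scalerA.
Qed.

HB.instance Definition _ f :=
  GRing.isLinear.Build K {malg K[T]} V _ (lin_ext f) (lin_ext_linear f).

Lemma lin_extU f t : lin_ext f << t >> = f t.
Proof. by rewrite /lin_ext msuppU oner_eq0 big_seq_fset1 mcoeffUU scale1r. Qed.

Lemma malg_lin_ind (P : {malg K[T]} -> Prop) :
  P 0 -> (forall c x y, P x -> P y -> P (c *: x + y)) ->
  (forall t, P << t >>) -> forall x, P x.
Proof.
move=> P0 PD PU x; rewrite (monalgE x).
elim: (msupp x : seq T) => [|t s IH]; first by rewrite big_nil.
rewrite big_cons; have -> : << x@_t *g t >> = x@_t *: << t >> :> {malg K[T]}.
  by apply/malgP=> k; rewrite mcoeffZ !mcoeffU mulr_natr.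
exact: PD.
Qed.

Lemma malg_linear_eq (f g : {malg K[T]} -> V) : linear f -> linear g ->
  (forall t, f << t >> = g << t >>) -> f =1 g.
Proof.
move=> lf lg h; have f0 : forall k : {malg K[T]} -> V, linear k -> k 0 = 0.
  move=> k lk; have := lk (-1) 0 0.
  by rewrite !scaleN1r addr0 oppr0 addNr.
apply: malg_lin_ind => //; first by rewrite !f0.
by move=> c x y hx hy; rewrite lf lg hx hy.
Qed.

End LinearExtension.

Section FreeOperad.
Variables (K : fieldType) (G : Type).

(* The component of arity n of the free operad on binary generators is the   *)
(* space spanned by the binary trees with n leaves and G-labelled nodes.     *)
Definition free_car (n : nat) : lmodType K := {malg K[ntree G n]}.

Definition free_unit : free_car 1 := << leaf_ntree G >>.

Definition free_pcomp n m k (e : (n + m)%N = k.+1) (i : 'I_n)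
    (x : free_car n) (y : free_car m) : free_car k :=
  lin_ext (fun t => lin_ext (fun s => << ntree_graft e i t s >> : free_car k) y) x.

Lemma free_pcomp_linearl n m k (e : (n + m)%N = k.+1) (i : 'I_n) y :
  linear (fun x => free_pcomp e i x y).
Proof. exact: lin_ext_linear. Qed.

Lemma free_pcomp_linearr n m k (e : (n + m)%N = k.+1) (i : 'I_n) x :
  linear (fun y => free_pcomp e i x y).
Proof.
move=> c u v; rewrite /free_pcomp /lin_ext scaler_sumr -big_split.
apply: eq_bigr => t _; rewrite -!/(lin_ext _ _) linearP scalerDr.
by rewrite !scalerA mulrC.
Qed.

Lemma free_pcompUU n m k (e : (n + m)%N = k.+1) (i : 'I_n)
    (t : ntree G n) (s : ntree G m) :
  free_pcomp e i << t >> << s >> = << ntree_graft e i t s >>.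
Proof. by rewrite /free_pcomp !lin_extU. Qed.

Lemma linear_compose (U V W : lmodType K) (f : V -> W) (g : U -> V) :
  linear f -> linear g -> linear (fun x => f (g x)).
Proof. by move=> lf lg c x y; rewrite lg lf. Qed.

Lemma free_pcomp_seq n m p nm mp k
      (e1 : (n + m)%N = nm.+1) (e2 : (nm + p)%N = k.+1)
      (e3 : (m + p)%N = mp.+1) (e4 : (n + mp)%N = k.+1)
      (i : 'I_n) (j : 'I_m) (l : 'I_nm) x y z :
    l = (i + j)%N :> nat ->
    free_pcomp e2 l (free_pcomp e1 i x y) z =
    free_pcomp e4 i x (free_pcomp e3 j y z).
Proof.
move=> h; pattern x; move: x; apply: malg_linear_eq => [||t].
- apply: (@linear_compose _ _ _ (fun x => free_pcomp e2 l x z)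
    (fun x => free_pcomp e1 i x y)); exact: free_pcomp_linearl.
- exact: free_pcomp_linearl.
pattern y; move: y; apply: malg_linear_eq => [||s].
- apply: (@linear_compose _ _ _ (fun x => free_pcomp e2 l x z)
    (free_pcomp e1 i << t >>)).
    exact: free_pcomp_linearl.
  exact: free_pcomp_linearr.
- apply: (@linear_compose _ _ _ (free_pcomp e4 i << t >>)
    (fun y => free_pcomp e3 j y z)).
    exact: free_pcomp_linearr.
  exact: free_pcomp_linearl.
pattern z; move: z; apply: malg_linear_eq => [||u].
- exact: free_pcomp_linearr.
- apply: (@linear_compose _ _ _ (free_pcomp e4 i << t >>)
    (free_pcomp e3 j << s >>)); exact: free_pcomp_linearr.
rewrite !free_pcompUU; congr << _ >>; apply: val_inj => /=.
by case: t s => [t /= /eqP ht] [s /= /eqP hs]; rewrite h graft_seq ?ht ?hs.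
Qed.

Lemma free_pcomp_par n m p nm np k
      (e1 : (n + m)%N = nm.+1) (e2 : (nm + p)%N = k.+1)
      (e3 : (n + p)%N = np.+1) (e4 : (np + m)%N = k.+1)
      (i j : 'I_n) (l : 'I_nm) (i' : 'I_np) x y z :
    (i < j)%N -> l.+1 = (j + m)%N -> i' = i :> nat ->
    free_pcomp e2 l (free_pcomp e1 i x y) z =
    free_pcomp e4 i' (free_pcomp e3 j x z) y.
Proof.
move=> hij hl hi; pattern x; move: x; apply: malg_linear_eq => [||t].
- apply: (@linear_compose _ _ _ (fun x => free_pcomp e2 l x z)
    (fun x => free_pcomp e1 i x y)); exact: free_pcomp_linearl.
- apply: (@linear_compose _ _ _ (fun x => free_pcomp e4 i' x y)
    (fun x => free_pcomp e3 j x z)); exact: free_pcomp_linearl.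
pattern y; move: y; apply: malg_linear_eq => [||s].
- apply: (@linear_compose _ _ _ (fun x => free_pcomp e2 l x z)
    (free_pcomp e1 i << t >>)).
    exact: free_pcomp_linearl.
  exact: free_pcomp_linearr.
- exact: free_pcomp_linearr.
pattern z; move: z; apply: malg_linear_eq => [||u].
- exact: free_pcomp_linearr.
- apply: (@linear_compose _ _ _ (fun x => free_pcomp e4 i' x << s >>)
    (free_pcomp e3 j << t >>)).
    exact: free_pcomp_linearl.
  exact: free_pcomp_linearr.
rewrite !free_pcompUU; congr << _ >>; apply: val_inj => /=.
case: t s => [t /= /eqP ht] [s /= /eqP hs]; rewrite hi.
have -> : nat_of_ord l = (j + leaves s).-1 by rewrite hs -hl.
by rewrite graft_par ?ht.
Qed.

Lemma free_pcomp_unitl n (e : (1 + n)%N = n.+1) x :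
  free_pcomp e ord0 free_unit x = x.
Proof.
pattern x; move: x; apply: (@malg_linear_eq _ _ (free_car n) _ id) => [|//|t].
  exact: free_pcomp_linearr.
by rewrite free_pcompUU; congr << _ >>; apply: val_inj.
Qed.

Lemma free_pcomp_unitr n (e : (n + 1)%N = n.+1) (i : 'I_n) x :
  free_pcomp e i x free_unit = x.
Proof.
pattern x; move: x; apply: (@malg_linear_eq _ _ (free_car n) _ id) => [|//|t].
  exact: free_pcomp_linearl.
rewrite free_pcompUU; congr << _ >>; apply: val_inj => /=.
by case: t => t /= /eqP ht; rewrite graft_leaf ?ht.
Qed.

Definition free_operad : operad K :=
  Operad free_pcomp_linearl free_pcomp_linearr free_pcomp_seq free_pcomp_par
    free_pcomp_unitl free_pcomp_unitr.

Definition gen (g : G) : free_operad 2 := << corolla g >>.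

Definition presented (R : free_operad 3 -> Prop) : operad K :=
  quotient_operad (gen_ideal R).

Definition presented_gen (R : free_operad 3 -> Prop) (g : G) : presented R 2 :=
  quot_class (gen_ideal R) (gen g).

(* The operad O admits the presentation (G, R), the generator g of the       *)
(* presentation corresponding to the element [h g] of O.                     *)
Definition has_presentation (O : operad K) (h : G -> O 2)
    (R : free_operad 3 -> Prop) : Prop :=
  exists phi : operad_morphism (presented R) O,
    operad_isomorphism phi /\ forall g, phi 2 (presented_gen R g) = h g.

End FreeOperad.

Section KoszulDual.
Variables (K : fieldType) (G : finType).

(* The basis elements x o_1 y and x o_2 y of the arity 3 component. *)
Definition tree_circ1 (x y : G) : ntree G 3 :=
  ntree_graft (erefl 4 : (2 + 2)%N = 3.+1) ord0 (corolla x) (corolla y).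
Definition tree_circ2 (x y : G) : ntree G 3 :=
  ntree_graft (erefl 4 : (2 + 2)%N = 3.+1) ord_max (corolla x) (corolla y).

Definition koszul_form (u v : free_operad K G 3) : K :=
  \sum_(x : G) \sum_(y : G)
    (u@_(tree_circ1 x y) * v@_(tree_circ1 x y)
     - u@_(tree_circ2 x y) * v@_(tree_circ2 x y)).

Lemma gen_circ1 (x y : G) : gen K x \circ1 gen K y = << tree_circ1 x y >>.
Proof. exact: free_pcompUU. Qed.

Lemma gen_circ2 (x y : G) : gen K x \circ2 gen K y = << tree_circ2 x y >>.
Proof. exact: free_pcompUU. Qed.

Lemma koszul_form_linearl v : linear (fun u => koszul_form u v : K^o).
Proof.
move=> c u w; rewrite /koszul_form scaler_sumr -big_split.
apply: eq_bigr => x _; rewrite scaler_sumr -big_split; apply: eq_bigr => y _ /=.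
by rewrite !mcoeffD !mcoeffZ /GRing.scale /=; ring.
Qed.

Lemma koszul_formC u v : koszul_form u v = koszul_form v u.
Proof.
by apply: eq_bigr => x _; apply: eq_bigr => y _; rewrite !(mulrC u@__).
Qed.

Lemma tree_circ1_eq x y x' y' :
  (tree_circ1 x y == tree_circ1 x' y') = (x == x') && (y == y').
Proof.
apply/eqP/andP => [/(congr1 val) /= [-> ->] //|[/eqP -> /eqP ->] //].
Qed.

Lemma tree_circ2_eq x y x' y' :
  (tree_circ2 x y == tree_circ2 x' y') = (x == x') && (y == y').
Proof.
apply/eqP/andP => [/(congr1 val) /= [-> ->] //|[/eqP -> /eqP ->] //].
Qed.

Lemma tree_circ12_eq x y x' y' : (tree_circ1 x y == tree_circ2 x' y') = false.
Proof. by apply/eqP => /(congr1 val). Qed.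

Lemma koszul_formUU (t s : ntree G 3) :
  koszul_form << t >> << s >> =
  \sum_(x : G) \sum_(y : G)
    ((t == tree_circ1 x y)%:R * (s == tree_circ1 x y)%:R
     - (t == tree_circ2 x y)%:R * (s == tree_circ2 x y)%:R).
Proof.
by apply: eq_bigr => x _; apply: eq_bigr => y _; rewrite !mcoeffU.
Qed.

Lemma sum_pair_eq (x y x' y' : G) :
  \sum_(z : G) \sum_(w : G)
    (((x == z) && (y == w))%:R * ((x' == z) && (y' == w))%:R : K) =
  ((x == x') && (y == y'))%:R.
Proof.
rewrite (bigD1 x) //= (bigD1 y) //= !big1 ?addr0.
- by rewrite !eqxx mul1r (eq_sym x') (eq_sym y').
- by move=> z nz; apply: big1 => w _; rewrite (eq_sym x) (negPf nz) mul0r.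
- by move=> w nw; rewrite (eq_sym y) (negPf nw) andbF mul0r.
Qed.

Lemma koszul_form_circ11 x y x' y' :
  koszul_form (gen K x \circ1 gen K y) (gen K x' \circ1 gen K y') =
  ((x == x') && (y == y'))%:R.
Proof.
rewrite (gen_circ1 x y) (gen_circ1 x' y') koszul_formUU -sum_pair_eq.
apply: eq_bigr => z _; apply: eq_bigr => w _.
by rewrite !tree_circ1_eq !tree_circ12_eq mul0r subr0.
Qed.

Lemma koszul_form_circ22 x y x' y' :
  koszul_form (gen K x \circ2 gen K y) (gen K x' \circ2 gen K y') =
  - ((x == x') && (y == y'))%:R.
Proof.
rewrite (gen_circ2 x y) (gen_circ2 x' y') koszul_formUU -sum_pair_eq -sumrN.
apply: eq_bigr => z _; rewrite -sumrN; apply: eq_bigr => w _.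
by rewrite !tree_circ2_eq !(eq_sym (tree_circ2 _ _)) !tree_circ12_eq mul0r sub0r.
Qed.

Lemma koszul_form_circ12 x y x' y' :
  koszul_form (gen K x \circ1 gen K y) (gen K x' \circ2 gen K y') = 0.
Proof.
rewrite (gen_circ1 x y) (gen_circ2 x' y') koszul_formUU.
apply: big1 => z _; apply: big1 => w _.
by rewrite tree_circ12_eq (eq_sym (tree_circ2 x' y')) tree_circ12_eq mul0r mulr0 subr0.
Qed.

Definition koszul_annihilator (R : free_operad K G 3 -> Prop) :
    free_operad K G 3 -> Prop :=
  fun v => forall u, R u -> koszul_form u v = 0.

Definition koszul_dual (R : free_operad K G 3 -> Prop) : operad K :=
  presented (koszul_annihilator R).

End KoszulDual.

Section Operads.
Variables (K : fieldType) (gamma : nat).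

(* An index a : 'I_gamma stands for the element a + 1 of {1, ..., gamma}.     *)
Implicit Types a b : 'I_gamma.

(* [inl a] and [inr a] are the left and right generators of index a: those   *)
(* of Dias_gamma, those of its Koszul dual, or those of the alternative      *)
(* presentation of the latter, depending on the operad under consideration.  *)
Definition generators : finType := ('I_gamma + 'I_gamma)%type.

Local Notation F := (free_operad K generators).

Definition gleft a : F 2 := gen K (inl a : generators).
Definition gright a : F 2 := gen K (inr a : generators).

Definition up a b : 'I_gamma := Order.max a b.

Lemma val_up a b : up a b = maxn a b :> nat.
Proof. by rewrite /up; case: (leqP a b) => h; [rewrite max_r|rewrite max_l // leEord ltnW]. Qed.

Section DiasRelators.
Local Notation dashv := gleft.
Local Notation vdash := gright.

Inductive dias_relator : F 3 -> Prop :=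
  | Dias1 a a' : dias_relator
      (dashv a \circ1 vdash a' - vdash a' \circ2 dashv a)
  | Dias2 a a' : dias_relator
      (dashv a \circ1 dashv (up a a') - dashv a \circ2 vdash a')
  | Dias3 a a' : dias_relator
      (vdash a \circ1 dashv a' - vdash a \circ2 vdash (up a a'))
  | Dias4 a a' : dias_relator
      (dashv (up a a') \circ1 dashv a - dashv a \circ2 dashv a')
  | Dias5 a a' : dias_relator
      (vdash a \circ1 vdash a' - vdash (up a a') \circ2 vdash a).
End DiasRelators.

Definition dias_relations : F 3 -> Prop := lspan dias_relator.

Definition Dias : operad K := presented dias_relations.

Definition Dendr : operad K := koszul_dual dias_relations.

(* The classes in Dendr_gamma of the sums, over the indices a <= b, of the   *)
(* left and right generators of index a.                                     *)
Definition Dendr_prec b : Dendr 2 :=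
  quot_class _ (\sum_(a < gamma | (a <= b)%N) gleft a).
Definition Dendr_succ b : Dendr 2 :=
  quot_class _ (\sum_(a < gamma | (a <= b)%N) gright a).

Definition Dendr_prec_succ (g : generators) : Dendr 2 :=
  match g with inl b => Dendr_prec b | inr b => Dendr_succ b end.

Section DendrRelators.
Local Notation prec := gleft.
Local Notation succ := gright.

Inductive dendr_relator : F 3 -> Prop :=
  | Dendr1 a a' : dendr_relator
      (prec a \circ1 succ a' - succ a' \circ2 prec a)
  | Dendr2 a b : (a < b)%N -> dendr_relator
      (prec a \circ1 prec b - prec a \circ2 succ b - prec a \circ2 prec a)
  | Dendr3 a b : (a < b)%N -> dendr_relator
      (succ a \circ1 succ a + succ a \circ1 prec b - succ a \circ2 succ b)
  | Dendr4 a b : (a < b)%N -> dendr_relator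
      (prec b \circ1 prec a - prec a \circ2 prec b - prec a \circ2 succ a)
  | Dendr5 a b : (a < b)%N -> dendr_relator
      (succ a \circ1 prec a + succ a \circ1 succ b - succ b \circ2 succ a)
  | Dendr6 a : dendr_relator
      (prec a \circ1 prec a - prec a \circ2 succ a - prec a \circ2 prec a)
  | Dendr7 a : dendr_relator
      (succ a \circ1 succ a + succ a \circ1 prec a - succ a \circ2 succ a).
End DendrRelators.

Definition dendr_relations : F 3 -> Prop := lspan dendr_relator.

End Operads.

(* Main.v *)
Require Import Defs.
From mathcomp Require Import all_boot all_order all_algebra.
From HB Require Import structures.
From mathcomp Require Import finmap.
From mathcomp.multinomials Require Import monalg.
From mathcomp Require Import zify ring.
(* Otherwise [pcomp] would denote [ssrfun.pcomp]. *)
Import Defs.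

(** Sending the generator b to the sum of the old generators a <= b is a
    unitriangular change of basis Z in arity 2, so by the universal property of
    free operads it extends to an automorphism of the free operad; it suffices
    that this automorphism carries the claimed relations onto the annihilator
    of the relations of Dias.  The seven kinds of relators are the values of
    three families indexed by arbitrary pairs (p, q), in which min (p, q)
    absorbs the case distinctions.  Orthogonality to Dias is a list of linear
    equations on coefficients, satisfied by the images of the families since
    a <= min (p, q) is (a <= p) && (a <= q) and max (a, a') <= p is
    (a <= p) && (a' <= p).  A solution is determined by three of its eight
    coefficient blocks, and each family realizes, through Z (x) Z, an arbitrary
    matrix in exactly one of these three blocks. *)

Set Implicit Arguments.
Unset Strict Implicit.
Unset Printing Implicit Defensive.

Import Order.TTheory GRing.Theory.
Local Open Scope ring_scope.

(** * Evaluation of trees in an operad *)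

Section TreeEvaluation.
Variables (K : fieldType) (O : operad K) (G : Type) (h : G -> O 2).

(** The unit is transported along an equation of arities because [tree_eval] takes its arity as a
    separate argument, only provably equal to the number of leaves. *)
Definition unit_at n (e : 1%N = n) : O n :=
  let: erefl := e in op_unit O.

Lemma node_arity1 (r : nat) : (2 + r)%N = r.+1.+1.
Proof. by []. Qed.

Lemma node_arity2 (l r n : nat) : (l + r)%N = n -> (r.+1 + l)%N = n.+1.
Proof. by move=> <-; rewrite addSn addnC. Qed.

(** The right subtree is inserted first, so that the left leaf of the root is still at position 0
    when its turn comes. *)
Fixpoint tree_eval (t : tree G) : forall n, leaves t = n -> O n :=
  match t return forall n, leaves t = n -> O n with
  | Leaf => unit_at
  | Node g l r => fun n e =>
      pcomp (node_arity2 e) ord0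
        (pcomp (node_arity1 (leaves r)) ord_max (h g)
           (@tree_eval r _ erefl))
        (@tree_eval l _ erefl)
  end.

(** Induction on [t]. A graft in the left subtree is sequential associativity; one in the right
    subtree must first pass the left subtree by parallel associativity. *)
Lemma tree_eval_graft t s n m k (e : (n + m)%N = k.+1) (i : 'I_n)
    (et : leaves t = n) (es : leaves s = m) (eg : leaves (graft t i s) = k) :
  tree_eval eg = pcomp e i (tree_eval et) (tree_eval es).
Proof.
elim: t n k e i et eg => [|g l IHl r IHr] n k e i et.
  case: n / et i e => i e eg.
  have -> : i = ord0 by apply: val_inj; case: (i) => -[].
  case: m / es e => e; case: k / eg e => /= e.
  by rewrite pcomp_unitl.
have il : (i < leaves l + leaves r)%N.
  by have := ltn_ord i; move: (nat_of_ord i) => j; rewrite -et.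
move=> eg.
case: n / et i e eg il => i e.
rewrite [graft _ _ _]/=; case: ltnP => hi eg il /=.
  have lg := leaves_graft s hi.
  rewrite (IHl _ _ _ (Ordinal hi) erefl erefl); first by rewrite lg es.
  move=> eg'.
  by rewrite (pcomp_seq _ _ eg' (node_arity2 eg) (j := Ordinal hi)).
have hr : (i - leaves l < leaves r)%N by rewrite ltn_subLR.
have rg := leaves_graft s hr.
rewrite (IHr _ _ _ (Ordinal hr) erefl erefl); first by rewrite rg es.
move=> er.
have e3 : ((leaves r).+1 + m)%N = (leaves (graft r (i - leaves l) s)).+2.
  by lia.
(* Before the left subtree is inserted, a single leaf stands in its place; hence the position
   [i - leaves l], shifted by one. *)
rewrite (pcomp_par (node_arity2 erefl) e e3 (node_arity2 eg)
  (i := ord0) (j := Ordinal (_ : (i - leaves l).+1 < (leaves r).+1)%N)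
  (i' := ord0)) //; last by rewrite /= addSn subnK.
rewrite (pcomp_seq (node_arity1 _) e3 er (node_arity1 _)
  (j := Ordinal hr)) //.
Qed.

End TreeEvaluation.

(** * Morphisms, generated ideals and quotients *)

Section Morphisms.
Variable K : fieldType.

Lemma subspace_preim (V W : lmodType K) (f : V -> W) (S : W -> Prop) :
  linear f -> subspace S -> subspace (fun v => S (f v)).
Proof.
move=> lf [S0 SD]; have f0 : f 0 = 0.
  by have := lf (-1) 0 0; rewrite !scaleN1r addr0 oppr0 addNr.
by split=> [|c u v hu hv]; rewrite ?f0 ?lf //; apply: SD.
Qed.

Lemma lspan_subspace (V : lmodType K) (S : V -> Prop) : subspace (lspan S).
Proof.
split=> [W [W0 _] _ //|c u v hu hv W hW hS].
by case: (hW) => _; apply; [apply: hu|apply: hv].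
Qed.

Lemma subspace_sum (V : lmodType K) (S : V -> Prop) (I : finType) (c : I -> K)
    (F : I -> V) :
  subspace S -> (forall i, S (F i)) -> S (\sum_i c i *: F i).
Proof. by case=> S0 SD hF; elim/big_rec: _ => // i v _ hv; apply: SD. Qed.

(** The preimage of an ideal under a morphism is an ideal, and a generated ideal lies in every ideal
    containing its generators. *)
Lemma mor_gen_ideal (O P : operad K) (f : operad_morphism O P) p
    (S : O p -> Prop) (J : ideal P) n (x : O n) :
  (forall y, S y -> J p (f p y)) -> gen_ideal S n x -> J n (f n x).
Proof.
move=> fS hx; pose fJ n (y : O n) := J n (f n y).
have sub m : subspace (@fJ m).
  by apply: subspace_preim (ideal_subspace J m); apply: linearP.
have idl n' m k (e : (n' + m)%N = k.+1) i (y : O n') (z : O m) :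
  fJ n' y -> fJ k (pcomp e i y z).
  by move=> hy; rewrite /fJ mor_pcomp; apply: ideal_pcompl.
have idr n' m k (e : (n' + m)%N = k.+1) i (y : O n') (z : O m) :
  fJ m z -> fJ k (pcomp e i y z).
  by move=> hz; rewrite /fJ mor_pcomp; apply: ideal_pcompr.
exact: (hx (Ideal sub idl idr)).
Qed.

Section QuotientMorphism.
Variables (O P : operad K) (I : ideal O) (J : ideal P).
Variable f : operad_morphism O P.
Hypothesis fI : forall n (x : O n), I n x -> J n (f n x).

(** Uses a chosen representative; [quot_mor_funE] shows that the choice is immaterial. *)
Definition quot_mor_fun n (a : quotient_operad I n) : quotient_operad J n :=
  quot_class J (f n (of_quot a)).

Lemma quot_mor_funE n (x : O n) :
  quot_mor_fun (quot_class I x) = quot_class J (f n x).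
Proof.
by apply/quot_classP; rewrite -linearB; apply: fI; apply: of_to_quot.
Qed.

Lemma quot_mor_fun_linear n : linear (@quot_mor_fun n).
Proof.
move=> c a b; have [x ->] := quot_class_surj a.
have [y ->] := quot_class_surj b.
by rewrite -linearP !quot_mor_funE linearP linearP.
Qed.

HB.instance Definition _ n := GRing.isLinear.Build K _ _ _
  (@quot_mor_fun n) (@quot_mor_fun_linear n).

Lemma quot_mor_unit :
  quot_mor_fun (op_unit (quotient_operad I)) = op_unit (quotient_operad J).
Proof. by rewrite [LHS]quot_mor_funE mor_unit. Qed.

Lemma quot_mor_pcomp n m k (e : (n + m)%N = k.+1) (i : 'I_n)
    (a : quotient_operad I n) (b : quotient_operad I m) :
  quot_mor_fun (pcomp e i a b) = pcomp e i (quot_mor_fun a) (quot_mor_fun b).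
Proof.
have [x ->] := quot_class_surj a; have [y ->] := quot_class_surj b.
by rewrite /= quot_pcompE !quot_mor_funE quot_pcompE mor_pcomp.
Qed.

Definition quot_mor : operad_morphism (quotient_operad I) (quotient_operad J) :=
  @OperadMorphism _ _ _ (fun n => @quot_mor_fun n) quot_mor_unit quot_mor_pcomp.

End QuotientMorphism.

End Morphisms.

(** * Universal property of the free operad *)

Section FreeMorphism.
Variables (K : fieldType) (G : Type).
Local Notation F := (free_operad K G).

Section Existence.
Variables (O : operad K) (h : G -> O 2).

Definition free_mor_fun n : F n -> O n :=
  lin_ext (fun t : ntree G n => tree_eval h (eqP (valP t))).

HB.instance Definition _ n := GRing.Linear.on (@free_mor_fun n).

Lemma free_mor_unit : free_mor_fun (op_unit F) = op_unit O.
Proof. by rewrite /free_mor_fun lin_extU /= (eq_irrelevance (eqP _) erefl). Qed.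

Lemma free_mor_pcomp n m k (e : (n + m)%N = k.+1) (i : 'I_n)
    (x : F n) (y : F m) :
  free_mor_fun (pcomp e i x y) = pcomp e i (free_mor_fun x) (free_mor_fun y).
Proof.
pattern x; move: x; apply: malg_linear_eq => [||t].
- by move=> c u v; rewrite pcomp_linearl linearP.
- by move=> c u v; rewrite linearP pcomp_linearl.
pattern y; move: y; apply: malg_linear_eq => [||s].
- by move=> c u v; rewrite pcomp_linearr linearP.
- by move=> c u v; rewrite linearP pcomp_linearr.
rewrite [pcomp e i _ _]free_pcompUU /free_mor_fun !lin_extU.
exact: tree_eval_graft.
Qed.

Definition free_mor : operad_morphism F O :=
  @OperadMorphism _ _ _ (fun n => @free_mor_fun n) free_mor_unit free_mor_pcomp.

Lemma free_mor_gen g : free_mor 2 (gen K g) = h g.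
Proof.
by rewrite /= /free_mor_fun lin_extU /= !pcomp_unitr.
Qed.

End Existence.

(** Every tree is an iterated composition of generators, by the same decomposition at the root as in
    [tree_eval]. *)
Lemma free_mor_unique (O : operad K) (f f' : operad_morphism F O) :
  (forall g, f 2 (gen K g) = f' 2 (gen K g)) -> forall n, f n =1 f' n.
Proof.
move=> ff' n; apply: malg_linear_eq => [||[t e]]; try exact: linearP.
elim: t n e => [|g l IHl r IHr] n e; move/eqP: (e) => en.
  case: n / en e => e.
  have -> : exist _ Leaf e = leaf_ntree G :> ntree G 1 by apply: val_inj.
  by rewrite [f 1 _]mor_unit [f' 1 _]mor_unit.
have -> : (<< (exist _ (Node g l r) e : ntree G n) >> : F n) =
  pcomp (node_arity2 en) ord0
    (pcomp (node_arity1 (leaves r)) ord_max (gen K g)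
      (<< (exist _ r (eqxx _) : ntree G (leaves r)) >> : F (leaves r)))
    (<< (exist _ l (eqxx _) : ntree G (leaves l)) >> : F (leaves l)).
  rewrite [pcomp (node_arity1 _) _ _ _]free_pcompUU [RHS]free_pcompUU.
  by congr << _ >>; apply: val_inj.
by rewrite !mor_pcomp ff' IHl IHr.
Qed.

End FreeMorphism.

(** * Transport of a presentation along an automorphism *)

Section ChangeOfGenerators.
Variables (K : fieldType) (G : Type).
Local Notation F := (free_operad K G).

(** The composite and the identity are morphisms that agree on generators, so uniqueness applies. *)
Lemma free_mor_cancel (f g : operad_morphism F F) :
  (forall x, f 2 (g 2 (gen K x)) = gen K x) -> forall n, cancel (g n) (f n).
Proof.
move=> fg; pose idm : operad_morphism F F :=
  @OperadMorphism _ _ _ (fun n => idfun) erefl (fun _ _ _ _ _ _ _ => erefl).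
have comp_unit : (f 1 \o g 1) (op_unit F) = op_unit F by rewrite /= !mor_unit.
have comp_pcomp n m k (e : (n + m)%N = k.+1) (i : 'I_n) (x : F n) (y : F m) :
  (f k \o g k) (pcomp e i x y) = pcomp e i ((f n \o g n) x) ((f m \o g m) y).
  by rewrite /= !mor_pcomp.
pose fgm : operad_morphism F F :=
  @OperadMorphism _ _ _ (fun n => f n \o g n) comp_unit comp_pcomp.
exact: (free_mor_unique (f := fgm) (f' := idm)).
Qed.

(** The mutually inverse [f] and [g] exchange the two generated ideals, hence descend to mutually
    inverse morphisms of the quotients. *)
Lemma has_presentation_change (R S : F 3 -> Prop) (f g : operad_morphism F F)
    (h : G -> presented S 2) :
  (forall x, f 2 (g 2 (gen K x)) = gen K x) ->
  (forall x, g 2 (f 2 (gen K x)) = gen K x) ->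
  (forall r, R r -> S (f 3 r)) -> (forall s, S s -> R (g 3 s)) ->
  (forall x, h x = quot_class (gen_ideal S) (f 2 (gen K x))) ->
  has_presentation h R.
Proof.
move=> /free_mor_cancel gK /free_mor_cancel fK fR gS hE.
have fI n (x : F n) : gen_ideal R n x -> gen_ideal S n (f n x).
  by apply: mor_gen_ideal => y Ry I; apply; apply: fR.
have gI n (x : F n) : gen_ideal S n x -> gen_ideal R n (g n x).
  by apply: mor_gen_ideal => y Sy I; apply; apply: gS.
exists (quot_mor fI); split=> [n|x]; last by rewrite hE; apply: quot_mor_funE.
exists (quot_mor gI n) => a; have [x ->] := quot_class_surj a.
  by rewrite /= (quot_mor_funE fI) (quot_mor_funE gI) fK.
by rewrite /= (quot_mor_funE gI) (quot_mor_funE fI) gK.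
Qed.

End ChangeOfGenerators.

(** * Coefficients in arities 2 and 3 *)

Section Coefficients.
Variables (K : fieldType) (G : finType).
Local Notation F := (free_operad K G).
Implicit Types (x y z w : G) (u v : F 2) (t : F 3).

Lemma ntree2P (s : ntree G 2) : exists x, s = corolla x.
Proof.
case: s => -[|x l r] // e; exists x; apply: val_inj => /=.
have := e; have := leaves_gt0 l; have := leaves_gt0 r.
case: l r e => [|? l1 l2] [|? r1 r2] //= _.
- by have := leaves_gt0 r1; have := leaves_gt0 r2; lia.
- by have := leaves_gt0 l1; have := leaves_gt0 l2; lia.
by have := leaves_gt0 r1; have := leaves_gt0 r2; lia.
Qed.

Lemma ntree3P (s : ntree G 3) :
  (exists x y, s = tree_circ1 x y) \/ (exists x y, s = tree_circ2 x y).
Proof.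
case: s => -[|x l r] // e.
(* The inner node is on the right in the first case, on the left in the second. *)
have /orP [/eqP el|/eqP el] : (leaves l == 1%N) || (leaves l == 2).
  have /= := eqP e; have := leaves_gt0 l; have := leaves_gt0 r; lia.
- have er : leaves r == 2 by have /= := eqP e; lia.
  case: l el e => [|? l1 l2] /=; last first.
    by have := leaves_gt0 l1; have := leaves_gt0 l2; lia.
  have [y /(congr1 val) /= ry] := ntree2P (exist _ r er).
  by move=> _ e; right; exists x, y; apply: val_inj => /=; rewrite ry.
have er : leaves r = 1%N by have /= := eqP e; lia.
case: r er e => [|? r1 r2] /=; last first.
  by have := leaves_gt0 r1; have := leaves_gt0 r2; lia.
have [y /(congr1 val) /= ly] := ntree2P (exist _ l (introT eqP el)).
by move=> _ e; left; exists x, y; apply: val_inj => /=; rewrite ly.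
Qed.

Lemma corolla_eq x y : (corolla x == corolla y) = (x == y).
Proof. by apply/eqP/eqP => [/(congr1 val) [->]|->]. Qed.

(** Treats both positions and both tree shapes at once: [b] tells whether they match. By bilinearity
    it is enough to compose corollas. *)
Lemma pcomp_coef (e : (2 + 2)%N = 4) (i : 'I_2) (s : ntree G 3)
    (z w : G) (b : bool) u v :
  (forall x y, (ntree_graft e i (corolla x) (corolla y) == s) =
    [&& b, x == z & y == w]) ->
  (pcomp e i u v)@_s = b%:R * (u@_(corolla z) * v@_(corolla w)).
Proof.
move=> hs; pattern u; move: u; apply: (@malg_linear_eq _ _ K^o) => [||su].
- by move=> a u u'; rewrite pcomp_linearl mcoeffD mcoeffZ.
- by move=> a u u'; rewrite mcoeffD mcoeffZ mulrDl mulrDr -mulrA mulrCA.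
pattern v; move: v; apply: (@malg_linear_eq _ _ K^o) => [||sv].
- by move=> a v v'; rewrite pcomp_linearr mcoeffD mcoeffZ.
- move=> a v v'; rewrite mcoeffD mcoeffZ !mulrDr; congr (_ + _).
  by rewrite ![_ * (a * _)]mulrCA.
have [x ->] := ntree2P su; have [y ->] := ntree2P sv.
by rewrite [pcomp _ _ _ _]free_pcompUU !mcoeffU hs !corolla_eq -!natrM !mulnb.
Qed.

Lemma circ1_coef1 u v x y :
  (u \circ1 v)@_(tree_circ1 x y) = u@_(corolla x) * v@_(corolla y).
Proof.
rewrite (pcomp_coef (z := x) (w := y) (b := true)) ?mul1r // => x' y'.
exact: tree_circ1_eq.
Qed.

Lemma circ1_coef2 u v x y : (u \circ1 v)@_(tree_circ2 x y) = 0.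
Proof.
rewrite (pcomp_coef (z := x) (w := y) (b := false)) ?mul0r // => x' y'.
exact: tree_circ12_eq.
Qed.

Lemma circ2_coef1 u v x y : (u \circ2 v)@_(tree_circ1 x y) = 0.
Proof.
rewrite (pcomp_coef (z := x) (w := y) (b := false)) ?mul0r // => x' y'.
by rewrite eq_sym; apply: tree_circ12_eq.
Qed.

Lemma circ2_coef2 u v x y :
  (u \circ2 v)@_(tree_circ2 x y) = u@_(corolla x) * v@_(corolla y).
Proof.
rewrite (pcomp_coef (z := x) (w := y) (b := true)) ?mul1r // => x' y'.
exact: tree_circ2_eq.
Qed.

Definition circ_coefE := (circ1_coef1, circ1_coef2, circ2_coef1, circ2_coef2).

(** Every relator of Dias has this shape. The minus sign of the relator cancels the one that the
    form puts on second compositions. *)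
Lemma koszul_form_diff x y x' y' t :
  koszul_form (gen K x \circ1 gen K y - gen K x' \circ2 gen K y') t =
  t@_(tree_circ1 x y) + t@_(tree_circ2 x' y').
Proof.
pose d z w z' w' : K := ((z == z') && (w == w'))%:R.
have delta z w (c : G -> G -> K) :
  \sum_z' \sum_w' d z w z' w' * c z' w' = c z w.
  rewrite pair_bigA (bigD1 (z, w)) //= /d !eqxx mul1r.
  rewrite big1 ?addr0 // => -[z' w'].
  by rewrite xpair_eqE eq_sym [w' == _]eq_sym /= => /negPf ->; rewrite mul0r.
rewrite -[t@_(tree_circ1 x y)](delta x y (fun z w => t@_(tree_circ1 z w))).
rewrite -[t@_(tree_circ2 x' y')](delta x' y' (fun z w => t@_(tree_circ2 z w))).
rewrite -big_split; apply: eq_bigr => z _; rewrite -big_split.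
apply: eq_bigr => w _; rewrite !mcoeffB !circ_coefE !mcoeffU !corolla_eq.
by rewrite subr0 sub0r mulNr opprK -!natrM !mulnb.
Qed.

End Coefficients.

(** * Linear changes of generators and the zeta matrix *)

Section Dendriform.
Variables (K : fieldType) (gamma : nat).
Local Notation G := (generators gamma).
Local Notation F := (free_operad K G).
Local Notation l := (inl : 'I_gamma -> G).
Local Notation r := (inr : 'I_gamma -> G).
Implicit Types (M N : 'M[K]_gamma) (t : F 3).

Definition generator_comb M (g : G) : F 2 :=
  match g with
  | inl b => \sum_a M b a *: gleft K a
  | inr b => \sum_a M b a *: gright K a
  end.

(** The block-diagonal matrix with both diagonal blocks equal to [M]. *)
Definition entry M (g g' : G) : K :=
  match g, g' with
  | inl b, inl a | inr b, inr a => M b a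
  | _, _ => 0
  end.

Lemma generator_comb_coef M g g' :
  (generator_comb M g)@_(corolla g') = entry M g g'.
Proof.
have sum_delta (c : 'I_gamma -> K) a : \sum_i c i * (i == a)%:R = c a.
  rewrite (bigD1 a) //= eqxx mulr1 big1 ?addr0 // => i /negPf ->.
  by rewrite mulr0.
case: g g' => b [] a; rewrite /= raddf_sum /=;
  under eq_bigr => i _ do rewrite mcoeffZ mcoeffU corolla_eq;
  by rewrite ?sum_delta // big1 // => i _; rewrite mulr0.
Qed.

Definition change M : operad_morphism F F := free_mor (generator_comb M).

Lemma change_gen M g : change M 2 (gen K g) = generator_comb M g.
Proof. exact: free_mor_gen. Qed.

(** Images of generators are the rows, so applying [change N] and then [change M] corresponds to the
    product [N *m M]. *)
Lemma changeK M N : N *m M = 1%:M ->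
  forall g, change M 2 (change N 2 (gen K g)) = gen K g.
Proof.
move=> NM g; move: (change M) (change_gen M) (change N) (change_gen N).
move=> f f_gen f' ->.
have sum_delta (v : 'I_gamma -> F 2) b :
  \sum_i (N b i *: \sum_a M i a *: v a) = v b.
  under eq_bigr => i _ do rewrite scaler_sumr.
  have /matrixP NME := NM; rewrite exchange_big /=.
  have -> : v b = \sum_a (b == a)%:R *: v a.
    rewrite (bigD1 b) //= eqxx scale1r big1 ?addr0 // => a.
    by rewrite eq_sym => /negPf ->; rewrite scale0r.
  apply: eq_bigr => a _; have := NME b a; rewrite !mxE => <-.
  by rewrite scaler_suml; apply: eq_bigr => i _; rewrite scalerA.
by case: g => b; rewrite /generator_comb linear_sum; under eq_bigr => i _ do
  rewrite linearZ f_gen; rewrite sum_delta.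
Qed.

(** The zeta matrix of the chain; row [b] expands $\prec_b$ and $\succ_b$ in the defining
    generators. *)
Definition zeta_mx : 'M[K]_gamma := \matrix_(b, a) (a <= b)%:R.

Lemma zeta_mx_unit : zeta_mx \in unitmx.
Proof.
rewrite unitmxE det_trig; last first.
  by apply/is_trig_mxP => b a ba; rewrite mxE leqNgt ba.
by rewrite big1 ?unitr1 // => a _; rewrite mxE leqnn.
Qed.

Local Notation Z := zeta_mx.

(** In matrix form the system reads [Z^T *m D *m Z = c], and [Z] is invertible. *)
Lemma zeta_comb (c : 'M[K]_gamma) : exists d : 'I_gamma * 'I_gamma -> K,
  forall i j, \sum_x d x * (Z x.1 i * Z x.2 j) = c i j.
Proof.
pose D := (invmx Z)^T *m c *m invmx Z.
have DE : Z^T *m D *m Z = c.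
  rewrite /D !mulmxA -trmx_mul mulVmx ?zeta_mx_unit // trmx1 mul1mx.
  by rewrite mulmxKV ?zeta_mx_unit.
exists (fun x => D x.1 x.2) => i j; rewrite -DE mxE.
rewrite -(pair_bigA _ (fun p q => D p q * (Z p i * Z q j))) exchange_big.
apply: eq_bigr => q _; rewrite [(_ *m D) i q]mxE mulr_suml.
apply: eq_bigr => p _.
by rewrite [Z^T i p]mxE mulrA [D p q * _]mulrC.
Qed.

(** * Equations of the annihilator, one for each kind of relator of Dias *)

Definition dual_equations t : Prop := forall a a' : 'I_gamma,
  [/\ t@_(tree_circ1 (l a) (r a')) + t@_(tree_circ2 (r a') (l a)) = 0,
      t@_(tree_circ1 (l a) (l (up a a'))) + t@_(tree_circ2 (l a) (r a')) = 0,
      t@_(tree_circ1 (r a) (l a')) + t@_(tree_circ2 (r a) (r (up a a'))) = 0,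
      t@_(tree_circ1 (l (up a a')) (l a)) + t@_(tree_circ2 (l a) (l a')) = 0
    & t@_(tree_circ1 (r a) (r a')) + t@_(tree_circ2 (r (up a a')) (r a)) = 0].

(** Conversely to testing on the relators, the elements orthogonal to [t] form a subspace, which
    contains the span as soon as it contains them. *)
Lemma dual_equationsP t :
  koszul_annihilator (@dias_relations K gamma) t <-> dual_equations t.
Proof.
split=> [ann a a'|eqs u du].
  split; rewrite -koszul_form_diff; apply: ann => W _; apply.
  - exact: Dias1.
  - exact: Dias2.
  - exact: Dias3.
  - exact: Dias4.
  exact: Dias5.
apply: (du (fun u => koszul_form u t = 0)) => [|_ [] a a'].
  apply: (@subspace_preim _ _ K^o (fun u => koszul_form u t) (fun c => c = 0)).
    exact: koszul_form_linearl.
  by split=> // c x y -> ->; rewrite scaler0 addr0.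
- by rewrite koszul_form_diff; case: (eqs a a').
- by rewrite koszul_form_diff; case: (eqs a a').
- by rewrite koszul_form_diff; case: (eqs a a').
- by rewrite koszul_form_diff; case: (eqs a a').
by rewrite koszul_form_diff; case: (eqs a a').
Qed.

Lemma dual_equations_subspace : subspace dual_equations.
Proof.
split=> [a a'|c u v hu hv a a'].
  by split; rewrite !mcoeff0 addr0.
have [u1 u2 u3 u4 u5] := hu a a'; have [v1 v2 v3 v4 v5] := hv a a'.
split; rewrite !mcoeffD !mcoeffZ addrACA -mulrDr.
- by rewrite u1 v1 mulr0 addr0.
- by rewrite u2 v2 mulr0 addr0.
- by rewrite u3 v3 mulr0 addr0.
- by rewrite u4 v4 mulr0 addr0.
by rewrite u5 v5 mulr0 addr0.
Qed.

(** Each equation ties one of the five other blocks to one of these three: the first uses the first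
    block, the second and fourth use the second, the third and fifth use the last. *)
Lemma dual_equations_eq0 t : dual_equations t ->
  (forall a b, t@_(tree_circ1 (l a) (r b)) = 0) ->
  (forall a b, t@_(tree_circ1 (l a) (l b)) = 0) ->
  (forall a b, t@_(tree_circ2 (r a) (r b)) = 0) -> t = 0.
Proof.
move=> eqs tlr tll trr; apply/malgP => s; rewrite mcoeff0.
have [[[x|x] [[y|y] ->]]|[[x|x] [[y|y] ->]]] := ntree3P s;
  rewrite ?tlr ?tll ?trr //.
- by have [_ _] := eqs x y; rewrite trr addr0.
- by have [_ _ _ _] := eqs x y; rewrite trr addr0.
- by have [_ _ _] := eqs x y; rewrite tll add0r.
- by have [_] := eqs x y; rewrite tll add0r.
by have [+ _ _ _ _] := eqs y x; rewrite tlr add0r.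
Qed.

(** * The three families of relators *)

Local Notation prec := (gleft K).
Local Notation succ := (gright K).

Definition dendr_family1 (p q : 'I_gamma) : F 3 :=
  prec p \circ1 succ q - succ q \circ2 prec p.

(** This is [Dendr2] for p < q, [Dendr6] for p = q and [Dendr4] for p > q. *)
Definition dendr_family2 (p q : 'I_gamma) : F 3 :=
  prec p \circ1 prec q - prec (Order.min p q) \circ2 succ q
    - prec (Order.min p q) \circ2 prec p.

(** This is [Dendr3] for p < q, [Dendr7] for p = q and [Dendr5] for p > q. *)
Definition dendr_family3 (p q : 'I_gamma) : F 3 :=
  succ (Order.min p q) \circ1 succ p + succ (Order.min p q) \circ1 prec q
    - succ p \circ2 succ q.

Lemma dendr_family_relations p q :
  [/\ dendr_relations (dendr_family1 p q), dendr_relations (dendr_family2 p q)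
    & dendr_relations (dendr_family3 p q)].
Proof.
rewrite /dendr_family1 /dendr_family2 /dendr_family3.
split=> W _; apply; first exact: Dendr1.
- have [pq|qp|/val_inj <-] := ltngtP p q.
  + rewrite min_l ?leEord 1?ltnW //; exact: Dendr2.
  + rewrite min_r ?leEord 1?ltnW // addrAC; exact: Dendr4.
  by rewrite minxx; apply: Dendr6.
have [pq|qp|/val_inj <-] := ltngtP p q.
- rewrite min_l ?leEord 1?ltnW //; exact: Dendr3.
- rewrite min_r ?leEord 1?ltnW // [_ + _ \circ1 _]addrC; exact: Dendr5.
by rewrite minxx; apply: Dendr7.
Qed.

Lemma dendr_relator_family t : dendr_relator t -> exists p q,
  [\/ t = dendr_family1 p q, t = dendr_family2 p q | t = dendr_family3 p q].
Proof.
rewrite /dendr_family1 /dendr_family2 /dendr_family3.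
case=> [a b|a b ab|a b ab|a b ab|a b ab|a|a].
- by exists a, b; constructor 1.
- by exists a, b; constructor 2; rewrite min_l // leEord ltnW.
- by exists a, b; constructor 3; rewrite min_l // leEord ltnW.
- exists b, a; constructor 2; rewrite min_r; first exact: addrAC.
  by rewrite leEord ltnW.
- exists b, a; constructor 3; rewrite min_r; last by rewrite leEord ltnW.
  exact: (congr1 (fun v => v - _) (addrC _ _)).
- by exists a, a; constructor 2; rewrite minxx.
by exists a, a; constructor 3; rewrite minxx.
Qed.

(** * Coefficients of the transformed families *)

Lemma change_circ1 M g g' : change M 3 (gen K g \circ1 gen K g') =
  generator_comb M g \circ1 generator_comb M g'.
Proof. by move: (change M) (change_gen M) => f fE; rewrite mor_pcomp !fE. Qed.

Lemma change_circ2 M g g' : change M 3 (gen K g \circ2 gen K g') =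
  generator_comb M g \circ2 generator_comb M g'.
Proof. by move: (change M) (change_gen M) => f fE; rewrite mor_pcomp !fE. Qed.

Lemma change_circ1_coef1 M g g' x y :
  (change M 3 (gen K g \circ1 gen K g'))@_(tree_circ1 x y) =
  entry M g x * entry M g' y.
Proof. by rewrite change_circ1 circ1_coef1 !generator_comb_coef. Qed.

Lemma change_circ1_coef2 M g g' x y :
  (change M 3 (gen K g \circ1 gen K g'))@_(tree_circ2 x y) = 0.
Proof. by rewrite change_circ1 circ1_coef2. Qed.

Lemma change_circ2_coef1 M g g' x y :
  (change M 3 (gen K g \circ2 gen K g'))@_(tree_circ1 x y) = 0.
Proof. by rewrite change_circ2 circ2_coef1. Qed.

Lemma change_circ2_coef2 M g g' x y :
  (change M 3 (gen K g \circ2 gen K g'))@_(tree_circ2 x y) =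
  entry M g x * entry M g' y.
Proof. by rewrite change_circ2 circ2_coef2 !generator_comb_coef. Qed.

Local Notation E := (entry Z).
Local Notation sub2 := (congr2 (fun u v => u - v)).
Local Notation add2 := (congr2 +%R).

(* The family coefficients are assembled from explicit terms: rewriting would
   make unification unfold [pcomp] to tell distinct compositions apart. *)
Lemma family1_coef1 p q x y :
  (change Z 3 (dendr_family1 p q))@_(tree_circ1 x y) = E (l p) x * E (r q) y.
Proof.
rewrite linearB mcoeffB -[RHS]subr0.
exact: sub2 (change_circ1_coef1 _ _ _ _ _) (change_circ2_coef1 _ _ _ _ _).
Qed.

Lemma family1_coef2 p q x y :
  (change Z 3 (dendr_family1 p q))@_(tree_circ2 x y) =
  - (E (r q) x * E (l p) y).
Proof.
rewrite linearB mcoeffB -[RHS]sub0r.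
exact: sub2 (change_circ1_coef2 _ _ _ _ _) (change_circ2_coef2 _ _ _ _ _).
Qed.

Lemma family2_coef1 p q x y :
  (change Z 3 (dendr_family2 p q))@_(tree_circ1 x y) = E (l p) x * E (l q) y.
Proof.
rewrite 2!linearB 2!mcoeffB -[RHS]subr0 -[X in _ = X - _]subr0.
apply: sub2 (change_circ2_coef1 _ _ _ _ _).
exact: sub2 (change_circ1_coef1 _ _ _ _ _) (change_circ2_coef1 _ _ _ _ _).
Qed.

Lemma family2_coef2 p q x y :
  (change Z 3 (dendr_family2 p q))@_(tree_circ2 x y) =
  - (E (l (Order.min p q)) x * E (r q) y) - E (l (Order.min p q)) x * E (l p) y.
Proof.
rewrite 2!linearB 2!mcoeffB -[X in _ = X - _]sub0r.
apply: sub2 (change_circ2_coef2 _ _ _ _ _).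
exact: sub2 (change_circ1_coef2 _ _ _ _ _) (change_circ2_coef2 _ _ _ _ _).
Qed.

Lemma family3_coef1 p q x y :
  (change Z 3 (dendr_family3 p q))@_(tree_circ1 x y) =
  E (r (Order.min p q)) x * E (r p) y + E (r (Order.min p q)) x * E (l q) y.
Proof.
rewrite linearB linearD mcoeffB mcoeffD -[RHS]subr0.
apply: sub2 (change_circ2_coef1 _ _ _ _ _).
exact: add2 (change_circ1_coef1 _ _ _ _ _) (change_circ1_coef1 _ _ _ _ _).
Qed.

Lemma family3_coef2 p q x y :
  (change Z 3 (dendr_family3 p q))@_(tree_circ2 x y) =
  - (E (r p) x * E (r q) y).
Proof.
rewrite linearB linearD mcoeffB mcoeffD -[RHS]sub0r.
apply: sub2 (change_circ2_coef2 _ _ _ _ _); rewrite -[RHS]addr0.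
exact: add2 (change_circ1_coef2 _ _ _ _ _) (change_circ1_coef2 _ _ _ _ _).
Qed.

(** * The transformed relations fill the annihilator *)

Lemma zeta_min p q a : Z (Order.min p q) a = Z p a * Z q a.
Proof.
rewrite !mxE.
have -> : Order.min p q = minn p q :> nat.
  by rewrite /Order.min /minn ltEord; case: ifP.
by rewrite -natrM mulnb leq_min.
Qed.

Lemma zeta_up p a b : Z p (up a b) = Z p a * Z p b.
Proof. by rewrite !mxE -natrM mulnb val_up geq_max. Qed.

(** Where the two terms of an equation do not vanish, they become opposite monomials. In the second
    equation for [dendr_family2], for instance, both are $Z_{p,a} Z_{q,a} Z_{q,a'}$ up to sign. *)
Lemma change_family_dual p q :
  [/\ dual_equations (change Z 3 (dendr_family1 p q)),
      dual_equations (change Z 3 (dendr_family2 p q))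
    & dual_equations (change Z 3 (dendr_family3 p q))].
Proof.
split.
- move: (change Z 3 _) (family1_coef1 p q) (family1_coef2 p q) => u u1 u2 a a'.
  by split; rewrite u1 u2 /= ?zeta_min ?zeta_up; ring.
- move: (change Z 3 _) (family2_coef1 p q) (family2_coef2 p q) => u u1 u2 a a'.
  by split; rewrite u1 u2 /= ?zeta_min ?zeta_up; ring.
move: (change Z 3 _) (family3_coef1 p q) (family3_coef2 p q) => u u1 u2 a a'.
by split; rewrite u1 u2 /= ?zeta_min ?zeta_up; ring.
Qed.

Lemma change_dendr_relations t : dendr_relations t ->
  koszul_annihilator (@dias_relations K gamma) (change Z 3 t).
Proof.
move=> dt; apply/dual_equationsP.
apply: (dt (fun u => dual_equations (change Z 3 u))).
  by apply: subspace_preim dual_equations_subspace; apply: linearP.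
move=> u /dendr_relator_family [p [q]].
by have [e1 e2 e3] := change_family_dual p q; case=> ->.
Qed.

Lemma linear_comb_coef (f : {linear F 3 -> F 3}) (I : finType) (c : I -> K)
    (v : I -> F 3) s :
  (f (\sum_i c i *: v i))@_s = \sum_i c i * (f (v i))@_s.
Proof.
rewrite linear_sum raddf_sum; apply: eq_bigr => i _.
by rewrite linearZ [LHS]mcoeffZ.
Qed.

(** The weights are chosen so that the image matches [t] on the three determining blocks; the
    difference then vanishes by [dual_equations_eq0]. *)
Lemma koszul_annihilator_image t :
  koszul_annihilator (@dias_relations K gamma) t ->
  exists2 w, dendr_relations w & change Z 3 w = t.
Proof.
move=> annt.
have [d1 d1E] := zeta_comb (\matrix_(i, j) t@_(tree_circ1 (l i) (r j))).
have [d2 d2E] := zeta_comb (\matrix_(i, j) t@_(tree_circ1 (l i) (l j))).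
(* The sign compensates the one in [family3_coef2]. *)
have [d3 d3E] := zeta_comb (\matrix_(i, j) - t@_(tree_circ2 (r i) (r j))).
pose w1 : F 3 := \sum_x d1 x *: dendr_family1 x.1 x.2.
pose w2 : F 3 := \sum_x d2 x *: dendr_family2 x.1 x.2.
pose w3 : F 3 := \sum_x d3 x *: dendr_family3 x.1 x.2.
have w_in : dendr_relations (w1 + w2 + w3).
  have sub := lspan_subspace (@dendr_relator K gamma); have [_ sub_lin] := sub.
  have sum_in d (fam : 'I_gamma -> 'I_gamma -> F 3) :
      (forall p q, dendr_relations (fam p q)) ->
      dendr_relations (\sum_x d x *: fam x.1 x.2).
    by move=> fam_in; apply: (subspace_sum d sub) => x; apply: fam_in.
  have := sub_lin 1 _ _ (sub_lin 1 w1 w2 _ _) (_ : dendr_relations w3).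
  by rewrite !scale1r; apply; apply: sum_in => p q;
    case: (dendr_family_relations p q).
exists (w1 + w2 + w3) => //; apply/eqP; rewrite -subr_eq0; apply/eqP.
have coefE s : (change Z 3 (w1 + w2 + w3) - t)@_s =
    \sum_x d1 x * (change Z 3 (dendr_family1 x.1 x.2))@_s +
    \sum_x d2 x * (change Z 3 (dendr_family2 x.1 x.2))@_s +
    \sum_x d3 x * (change Z 3 (dendr_family3 x.1 x.2))@_s - t@_s.
  rewrite mcoeffB; congr (_ - _); rewrite linearD mcoeffD linearD mcoeffD.
  by congr (_ + _ + _); apply: linear_comb_coef.
have ann := change_dendr_relations w_in.
apply: dual_equations_eq0 => [|a b|a b|a b].
- have [_ sub_lin] := dual_equations_subspace.
  by rewrite -scaleN1r addrC; apply: sub_lin; apply/dual_equationsP.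
(* In this block only the first family contributes: the others carry a factor [entry] between a left
   and a right generator. The next two blocks likewise isolate the second and the third family. *)
- rewrite coefE.
  under [X in X + _ + _ - _]eq_bigr => x _ do rewrite family1_coef1 /=.
  under [X in _ + X + _ - _]eq_bigr => x _ do
    rewrite family2_coef1 /= mulr0 mulr0.
  under [X in _ + _ + X - _]eq_bigr => x _ do
    rewrite family3_coef1 /= !mul0r addr0 mulr0.
  by rewrite d1E mxE !big1_eq !addr0 subrr.
- rewrite coefE.
  under [X in X + _ + _ - _]eq_bigr => x _ do
    rewrite family1_coef1 /= mulr0 mulr0.
  under [X in _ + X + _ - _]eq_bigr => x _ do rewrite family2_coef1 /=.
  under [X in _ + _ + X - _]eq_bigr => x _ do
    rewrite family3_coef1 /= !mul0r addr0 mulr0.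
  by rewrite d2E mxE !big1_eq add0r addr0 subrr.
rewrite coefE.
under [X in X + _ + _ - _]eq_bigr => x _ do
  rewrite family1_coef2 /= mulr0 oppr0 mulr0.
under [X in _ + X + _ - _]eq_bigr => x _ do
  rewrite family2_coef2 /= !mul0r subr0 oppr0 mulr0.
under [X in _ + _ + X - _]eq_bigr => x _ do rewrite family3_coef2 /= mulrN.
by rewrite sumrN d3E mxE !big1_eq !add0r opprK subrr.
Qed.

End Dendriform.

(** * The presentation of the dual operad *)

Theorem theorem4p1p4 (K : fieldType) (charK0 : [pchar K]%R =i pred0)
    (gamma : nat) :
  @has_presentation K (generators gamma) (Dendr K gamma)
    (@Dendr_prec_succ K gamma) (@dendr_relations K gamma).
Proof.
have ZK := changeK (mulmxV (zeta_mx_unit K gamma)).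
have KZ := changeK (mulVmx (zeta_mx_unit K gamma)).
apply: (has_presentation_change KZ ZK) => [u|u|g].
- exact: change_dendr_relations.
(* An element of the annihilator is the image of some relation [w], which the inverse change of
   generators recovers. *)
- by case/koszul_annihilator_image=> w dw <-; rewrite (free_mor_cancel ZK).
rewrite (change_gen _ g) /Dendr_prec_succ /Dendr_prec /Dendr_succ.
by case: g => b; congr (quot_class _ _); rewrite big_mkcond;
  apply: eq_bigr => a _; rewrite mxE; case: leqP; rewrite ?scale1r ?scale0r.
Qed.
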